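(* Let $\Omega\subseteq\mathbb{H}$ be a slice domain and let $f:\Omega\to\mathbb{H}$ be regular. If $|f|$ has a relative maximum at some $p\in\Omega$, then $f$ is constant.
   Context: $\mathbb{H}$ is the real algebra of quaternions, with modulus $|\cdot|$; $\mathbb{S}=\{q\in\mathbb{H}: q^2=-1\}$ is the 2-sphere of imaginary units, and for $I\in\mathbb{S}$, $L_I=\mathbb{R}+I\mathbb{R}\simeq\mathbb{C}$. A domain is a connected open set. For a domain $\Omega\subseteq\mathbb{H}$ put $\Omega_I=\Omega\cap L_I$. A function $f:\Omega\to\mathbb{H}$ on a domain $\Omega\subseteq\mathbb{H}$ is (slice) regular if for every $I\in\mathbb{S}$ the restriction $f_I=f|_{\Omega_I}$ is holomorphic, meaning $f_I\in C^1(\Omega_I)$ and $\frac12\left(\frac{\partial}{\partial x}+I\frac{\partial}{\partial y}\right)f_I(x+Iy)=0$ on $\Omega_I$. A slice domain is a domain $\Omega\subseteq\mathbb{H}$ intersecting the real axis such that $\Omega_I$ is a domain in $L_I$ for all $I\in\mathbb{S}$. *)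

(* Defs.v *)
From HB Require Import structures.
From mathcomp Require Import all_boot all_order all_algebra.
From mathcomp Require Import ring lra.
From mathcomp Require Import all_classical all_reals all_analysis.

Set Implicit Arguments.
Unset Strict Implicit.
Unset Printing Implicit Defensive.

Import Order.TTheory GRing.Theory Num.Theory.
Import numFieldNormedType.Exports.

Local Open Scope classical_set_scope.
Local Open Scope ring_scope.

(* [Quat a b c d] stands for a + b i + c j + d k. *)
Record quat (R : Type) : Type := Quat { q1 : R; qi : R; qj : R; qk : R }.

Definition tuple_of_quat (R : Type) (q : quat R) : R * R * R * R :=
  (q1 q, qi q, qj q, qk q).
Definition quat_of_tuple (R : Type) (t : R * R * R * R) : quat R :=
  Quat t.1.1.1 t.1.1.2 t.1.2 t.2.

Lemma tuple_of_quatK (R : Type) : cancel (@tuple_of_quat R) (@quat_of_tuple R).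
Proof. by case. Qed.

HB.instance Definition _ (R : choiceType) :=
  Choice.copy (quat R) (can_type (@tuple_of_quatK R)).

Section QuaternionAlgebra.
Variable R : realType.
Implicit Types p q r : quat R.

Definition addq p q :=
  Quat (q1 p + q1 q) (qi p + qi q) (qj p + qj q) (qk p + qk q).
Definition oppq q := Quat (- q1 q) (- qi q) (- qj q) (- qk q).
Definition scaleq (a : R) q := Quat (a * q1 q) (a * qi q) (a * qj q) (a * qk q).

(* Hamilton's product: i^2 = j^2 = k^2 = ijk = -1. *)
Definition mulq p q :=
  Quat (q1 p * q1 q - qi p * qi q - qj p * qj q - qk p * qk q)
       (q1 p * qi q + qi p * q1 q + qj p * qk q - qk p * qj q)
       (q1 p * qj q - qi p * qk q + qj p * q1 q + qk p * qi q)
       (q1 p * qk q + qi p * qj q - qj p * qi q + qk p * q1 q).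

Lemma quat_eq p q :
  q1 p = q1 q -> qi p = qi q -> qj p = qj q -> qk p = qk q -> p = q.
Proof. by case: p q => ? ? ? ? [? ? ? ?] /= -> -> -> ->. Qed.

Fact addqA : associative addq.
Proof. by move=> p q r; apply: quat_eq; rewrite /= addrA. Qed.
Fact addqC : commutative addq.
Proof. by move=> p q; apply: quat_eq; rewrite /= addrC. Qed.
Fact add0q : left_id (Quat 0 0 0 0) addq.
Proof. by move=> p; apply: quat_eq; rewrite /= add0r. Qed.
Fact addNq : left_inverse (Quat 0 0 0 0) oppq addq.
Proof. by move=> p; apply: quat_eq; rewrite /= addNr. Qed.

HB.instance Definition _ :=
  GRing.isZmodule.Build (quat R) addqA addqC add0q addNq.

Fact mulqA : associative mulq.
Proof. by move=> p q r; apply: quat_eq => /=; ring. Qed.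
Fact mul1q : left_id (Quat 1 0 0 0) mulq.
Proof. by move=> p; apply: quat_eq => /=; ring. Qed.
Fact mulq1 : right_id (Quat 1 0 0 0) mulq.
Proof. by move=> p; apply: quat_eq => /=; ring. Qed.
Fact mulqDl : left_distributive mulq +%R.
Proof. by move=> p q r; apply: quat_eq => /=; ring. Qed.
Fact mulqDr : right_distributive mulq +%R.
Proof. by move=> p q r; apply: quat_eq => /=; ring. Qed.
Fact oneq_neq0 : Quat 1 0 0 0 != 0 :> quat R.
Proof. by apply/eqP => -[/eqP]; rewrite oner_eq0. Qed.

HB.instance Definition _ := GRing.Zmodule_isNzRing.Build (quat R)
  mulqA mul1q mulq1 mulqDl mulqDr oneq_neq0.

Fact scaleqA (a b : R) q : scaleq a (scaleq b q) = scaleq (a * b) q.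
Proof. by apply: quat_eq; rewrite /= mulrA. Qed.
Fact scale1q : left_id 1 scaleq.
Proof. by move=> q; apply: quat_eq; rewrite /= mul1r. Qed.
Fact scaleqDr : right_distributive scaleq +%R.
Proof. by move=> a p q; apply: quat_eq; rewrite /= mulrDr. Qed.
Fact scaleqDl q : {morph scaleq^~ q : a b / a + b}.
Proof. by move=> a b; apply: quat_eq; rewrite /= mulrDl. Qed.

HB.instance Definition _ := GRing.Zmodule_isLmodule.Build R (quat R)
  scaleqA scale1q scaleqDr scaleqDl.

Fact scaleqAl (a : R) p q : a *: (p * q) = (a *: p) * q.
Proof. by apply: quat_eq => /=; ring. Qed.
HB.instance Definition _ := GRing.Lmodule_isLalgebra.Build R (quat R) scaleqAl.

Fact scaleqAr (a : R) p q : a *: (p * q) = p * (a *: q).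
Proof. by apply: quat_eq => /=; ring. Qed.
HB.instance Definition _ := GRing.Lalgebra_isAlgebra.Build R (quat R) scaleqAr.

Definition normq q : R :=
  Num.sqrt (q1 q ^+ 2 + qi q ^+ 2 + qj q ^+ 2 + qk q ^+ 2).

Fact normq_sq_ge0 q : 0 <= q1 q ^+ 2 + qi q ^+ 2 + qj q ^+ 2 + qk q ^+ 2.
Proof. by rewrite !addr_ge0 ?sqr_ge0. Qed.

Fact ler_normqD p q : normq (p + q) <= normq p + normq q.
Proof.
have [p0 q0] : 0 <= normq p /\ 0 <= normq q by rewrite !sqrtr_ge0.
have sqE r : normq r ^+ 2 = q1 r ^+ 2 + qi r ^+ 2 + qj r ^+ 2 + qk r ^+ 2.
  by rewrite sqr_sqrtr ?normq_sq_ge0.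
rewrite -(@ler_pXn2r _ 2) ?nnegrE ?addr_ge0 ?sqrtr_ge0//.
rewrite sqrrD !sqE /=.
set s := q1 p * q1 q + qi p * qi q + qj p * qj q + qk p * qk q.
have sle : s <= normq p * normq q.
  apply: (le_trans (ler_norm _)).
  rewrite -(@ler_pXn2r _ 2) ?nnegrE ?mulr_ge0 ?normr_ge0// exprMn !sqE.
  rewrite real_normK ?num_real// -subr_ge0.
  rewrite [leRHS](_ : _ =
    (q1 p * qi q - qi p * q1 q) ^+ 2 + (q1 p * qj q - qj p * q1 q) ^+ 2 +
    (q1 p * qk q - qk p * q1 q) ^+ 2 + (qi p * qj q - qj p * qi q) ^+ 2 +
    (qi p * qk q - qk p * qi q) ^+ 2 + (qj p * qk q - qk p * qj q) ^+ 2);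
    last by rewrite /s; ring.
  by rewrite !addr_ge0 ?sqr_ge0.
rewrite -subr_ge0 [leRHS](_ : _ = 2 * (normq p * normq q - s));
  last by rewrite /s; ring.
by rewrite mulr_ge0// subr_ge0.
Qed.

Fact normqZ (a : R) q : normq (a *: q) = `|a| * normq q.
Proof.
rewrite /normq /= -sqrtr_sqr -sqrtrM ?sqr_ge0//.
by congr Num.sqrt; ring.
Qed.

Fact normq_eq0 q : normq q = 0 -> q = 0.
Proof.
move=> /eqP; rewrite sqrtr_eq0 => q0.
have := sqr_ge0 (q1 q); have := sqr_ge0 (qi q).
have := sqr_ge0 (qj q); have := sqr_ge0 (qk q).
move: q0 => q0 k0 j0 i0 r0.
by apply: quat_eq; apply/eqP; rewrite -sqrf_eq0 eq_le; apply/andP; split => //;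
  lra.
Qed.

(* The topology of [quat R] is the one induced by the modulus [normq]. *)
HB.instance Definition _ :=
  Lmodule_isNormed.Build R (quat R) ler_normqD normqZ normq_eq0.

End QuaternionAlgebra.

Definition domain (T : topologicalType) (D : set T) : Prop :=
  open D /\ connected D.

Section SliceRegular.
Variable R : realType.
Local Notation H := (quat R).
Implicit Types (Omega : set H) (f : H -> H) (I : H).

Definition unit_sphere : set H := [set q | q ^+ 2 = -1].

(* The identification z = (x, y) |-> x + I y of the plane with L_I. *)
Definition slice_pt I (z : R * R) : H := z.1%:A + I * z.2%:A.

(* Omega_I and f_I, read in the coordinates (x, y) of L_I. *)
Definition slice I Omega : set (R * R) := [set z | Omega (slice_pt I z)].
Definition slice_fun I f : R * R -> H := fun z => f (slice_pt I z).

(* C^1 means that both partial derivatives exist and are continuous; it is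
   meant for an open set U, so that only the values of g on U matter. *)
Definition C1_on (U : set (R * R)) (g : R * R -> H) : Prop :=
  [/\ forall z, U z -> derivable g z (1, 0),
      forall z, U z -> derivable g z (0, 1),
      {within U, continuous (fun z => 'D_(1, 0) g z)} &
      {within U, continuous (fun z => 'D_(0, 1) g z)}].

Definition holomorphic_on I (U : set (R * R)) (g : R * R -> H) : Prop :=
  C1_on U g /\
  forall z, U z -> 2^-1 *: ('D_(1, 0) g z + I * 'D_(0, 1) g z) = 0.

(* A function on Omega is a total function of which only the values on Omega
   are used: with Omega open, [regular Omega f] does not depend on the values
   of f outside Omega. *)
Definition regular Omega f : Prop :=
  forall I, unit_sphere I -> holomorphic_on I (slice I Omega) (slice_fun I f).

Definition slice_domain Omega : Prop :=
  [/\ domain Omega,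
      exists x : R, Omega x%:A &
      forall I, unit_sphere I -> domain (slice I Omega)].

Definition relative_max (D : set H) (u : H -> R) (p : H) : Prop :=
  D p /\ \forall q \near p, D q -> u q <= u p.

End SliceRegular.

(* Main.v *)
Require Import Defs.
From mathcomp Require Import all_boot all_order all_algebra.
From mathcomp Require Import all_classical all_reals all_analysis.
From mathcomp Require Import ring lra.

(** Fix an imaginary unit I. Along the complex line L_I a regular function is
    holomorphic with values in the complex vector space of quaternions, on which
    L_I acts by left multiplication. The vector-valued maximum principle and the
    identity principle of one complex variable therefore apply. Choose L_I through
    the point p: the restriction of f is constant near p, hence on the whole
    connected slice, and in particular on the real points of Omega. These belong to
    every other slice, so the identity principle, started from a real interval,
    propagates the same constant to all slices, and the slices cover Omega.

    Complex analysis is developed just as far as this requires, without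
    integrals. A C^1 solution of the Cauchy-Riemann equation is strictly
    differentiable ([regular_slice_diff]), and strict differentiability yields an
    approximate mean value property over the vertices of fine regular polygons
    ([discrete_mean]). Vectors of norm at most |c| can only average to c if they
    all equal c, which gives the strong maximum principle ([slice_strong_max])
    and from it the maximum principle on compact sets ([slice_weak_max]).

    The identity principle follows from the maximum principle alone: applied to
    (z - a)^(-n) f with n tending to infinity, it shows that f vanishes at the
    points of a compact set K that lie closer to a than rho, provided that f
    vanishes at every boundary point of K closer to a than rho ([slice_vanish]).
    Taking an annulus for K extends zeros from a disc to a larger disc
    ([slice_const_disc]); taking a lens bounded by a real segment and a circular arc
    extends them from the real axis into a half-plane ([slice_const_real]). *)

Import Order.TTheory GRing.Theory Num.Theory.
Import numFieldNormedType.Exports.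

Local Open Scope classical_set_scope.
Local Open Scope ring_scope.

Section SliceAnalysis.
Set Implicit Arguments.
Unset Strict Implicit.
Unset Printing Implicit Defensive.

Context {R : realType}.
Local Notation H := (quat R).
Implicit Types p q a w z I : H.

(** * Modulus and inner product *)

Lemma sqr_norm_quat q :
  `|q| ^+ 2 = q1 q ^+ 2 + qi q ^+ 2 + qj q ^+ 2 + qk q ^+ 2.
Proof. by rewrite [`|q|]/(Defs.normq q) sqr_sqrtr ?normq_sq_ge0. Qed.

Lemma norm_quatM p q : `|p * q| = `|p| * `|q|.
Proof.
apply/eqP; rewrite -(@eqrXn2 _ 2) ?mulr_ge0//.
rewrite exprMn !sqr_norm_quat /=; apply/eqP; ring.
Qed.

Definition dotq p q : R :=
  q1 p * q1 q + qi p * qi q + qj p * qj q + qk p * qk q.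

Lemma dotqq q : dotq q q = `|q| ^+ 2.
Proof. by rewrite sqr_norm_quat /dotq -!expr2. Qed.
Lemma dotqDr p q q' : dotq p (q + q') = dotq p q + dotq p q'.
Proof. by rewrite /dotq /=; ring. Qed.
Lemma dotqBr p q q' : dotq p (q - q') = dotq p q - dotq p q'.
Proof. by rewrite /dotq /=; ring. Qed.
Lemma dotqZr p (a : R) q : dotq p (a *: q) = a * dotq p q.
Proof. by rewrite /dotq /=; ring. Qed.
Lemma sqr_normB p q : `|p - q| ^+ 2 = `|p| ^+ 2 - 2 * dotq p q + `|q| ^+ 2.
Proof. by rewrite !sqr_norm_quat /dotq /=; ring. Qed.
Lemma sqr_normD p q : `|p + q| ^+ 2 = `|p| ^+ 2 + 2 * dotq p q + `|q| ^+ 2.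
Proof. by rewrite !sqr_norm_quat /dotq /=; ring. Qed.
Lemma dotq_le p q : `|dotq p q| <= `|p| * `|q|.
Proof.
have h (s t : H) : dotq s t <= `|s| * `|t|.
  have : `|s + t| ^+ 2 <= (`|s| + `|t|) ^+ 2.
    by rewrite lerXn2r ?nnegrE ?addr_ge0// ler_normD.
  by rewrite sqr_normD; lra.
rewrite ler_norml h andbT lerNl (le_trans _ (_ : dotq (- p) q <= _)) ?normrN//.
  by rewrite /dotq /=; lra.
by rewrite -(normrN p) h.
Qed.

(** * Inverses and the complex lines *)

Definition quatV q : H :=
  (`|q| ^+ 2)^-1 *: Quat (q1 q) (- qi q) (- qj q) (- qk q).

Lemma norm_quat1 : `|1 : H| = 1.
Proof.
apply/eqP; rewrite -(@eqrXn2 _ 2)// expr1n sqr_norm_quat /=.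
by apply/eqP; ring.
Qed.

Lemma mulqV q : q != 0 -> q * quatV q = 1.
Proof.
move=> q0; have n0 : q1 q ^+ 2 + qi q ^+ 2 + qj q ^+ 2 + qk q ^+ 2 != 0.
  by rewrite -sqr_norm_quat sqrf_eq0 normr_eq0.
by apply: quat_eq; rewrite /= sqr_norm_quat; field.
Qed.

Lemma norm_quatV q : q != 0 -> `|quatV q| = `|q|^-1.
Proof.
move=> q0; apply: (mulfI (_ : `|q| != 0)); first by rewrite normr_eq0.
by rewrite -norm_quatM mulqV// norm_quat1 divff// normr_eq0.
Qed.

(** The imaginary part of I^2 is 2 (Re I) times that of I. So if Re I were nonzero,
    then I would be real and its square nonnegative. *)
Lemma unit_sphereP I : unit_sphere I ->
  q1 I = 0 /\ qi I ^+ 2 + qj I ^+ 2 + qk I ^+ 2 = 1.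
Proof.
rewrite /unit_sphere /= expr2 => h.
have := congr1 (@q1 R) h; have := congr1 (@qi R) h.
have := congr1 (@qj R) h; have := congr1 (@qk R) h => /= {h} hk hj hi h1.
have I0 : q1 I = 0.
  apply/eqP; rewrite -[_ == 0]negbK; apply/negP => I0.
  have z (x : R) : q1 I * x + x * q1 I = 0 -> x = 0.
    move=> h; apply/eqP; rewrite -(mulrI_eq0 x (mulfI I0)); apply/eqP; lra.
  have := z (qi I); have := z (qj I); have := z (qk I).
  move=> /(_ ltac:(lra)) k0 /(_ ltac:(lra)) j0 /(_ ltac:(lra)) i0.
  by move: h1; rewrite i0 j0 k0; have := sqr_ge0 (q1 I); rewrite expr2; lra.
by split => //; move: h1; rewrite I0 !expr2; lra.
Qed.

Lemma norm_unit I : unit_sphere I -> `|I| = 1.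
Proof.
move=> /unit_sphereP[I0 I1]; apply/eqP.
rewrite -(@eqrXn2 _ 2)// expr1n sqr_norm_quat I0 expr0n add0r; apply/eqP; lra.
Qed.

Lemma norm_slice_pt I (z : R * R) : unit_sphere I ->
  `|slice_pt I z| ^+ 2 = z.1 ^+ 2 + z.2 ^+ 2.
Proof.
move=> /unit_sphereP[I0 I1]; rewrite sqr_norm_quat /= I0.
have := congr1 (fun t => t * z.2 ^+ 2) I1 => /= I1'.
by lra.
Qed.

(** The complex line L_I; it is handled as a subset of the quaternions, so that
    slice holomorphy can be phrased with the quaternionic product itself. *)
Definition line I : set H := range (slice_pt I).

Lemma slice_ptD I (z w : R * R) :
  slice_pt I (z + w) = slice_pt I z + slice_pt I w.
Proof. by rewrite /slice_pt /= !scalerDl mulrDr addrACA. Qed.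

Lemma slice_ptZ I (t : R) (z : R * R) : slice_pt I (t *: z) = t *: slice_pt I z.
Proof. by rewrite /slice_pt /= scalerDr !scalerA scalerAr scalerA. Qed.

Lemma slice_ptM I (z w : R * R) : unit_sphere I ->
  slice_pt I z * slice_pt I w =
  slice_pt I (z.1 * w.1 - z.2 * w.2, z.1 * w.2 + z.2 * w.1).
Proof.
move=> /unit_sphereP[I0 I1].
have := congr1 (fun t => t * (z.2 * w.2)) I1 => /= I1'.
by apply: quat_eq; rewrite /= !I0; lra.
Qed.

Lemma lineD I p q : line I p -> line I q -> line I (p + q).
Proof. by move=> [z _ <-] [w _ <-]; exists (z + w) => //; rewrite slice_ptD. Qed.

Lemma lineZ I (t : R) q : line I q -> line I (t *: q).
Proof. by move=> [z _ <-]; exists (t *: z) => //; rewrite slice_ptZ. Qed.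

Lemma lineN I q : line I q -> line I (- q).
Proof. by rewrite -scaleN1r; exact: lineZ. Qed.

Lemma lineB I p q : line I p -> line I q -> line I (p - q).
Proof. by move=> pI qI; apply: lineD => //; exact: lineN. Qed.

Lemma line_real I (x : R) : line I x%:A.
Proof. by exists (x, 0) => //; rewrite /slice_pt /= scale0r mulr0 addr0. Qed.

Lemma line1 I : line I 1.
Proof. by rewrite -(scale1r 1); exact: line_real. Qed.

Lemma lineM I p q : unit_sphere I -> line I p -> line I q -> line I (p * q).
Proof. by move=> I1 [z _ <-] [w _ <-]; rewrite slice_ptM//; eexists. Qed.

Lemma lineC I p q : unit_sphere I -> line I p -> line I q -> p * q = q * p.
Proof.
move=> I1 [z _ <-] [w _ <-]; rewrite !slice_ptM//; congr slice_pt.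
by congr pair; ring.
Qed.

Lemma lineV I q : unit_sphere I -> line I q -> line I (quatV q).
Proof.
move=> I1 [z _ <-]; apply: lineZ; exists (z.1, - z.2) => //.
have [I0 _] := unit_sphereP I1.
by apply: quat_eq; rewrite /= !I0; ring.
Qed.

(** * Strict complex differentiability along a slice *)

Lemma near_dist_lt z (e : R) : 0 < e -> \forall x \near z, `|z - x| < e.
Proof.
by move=> e0; have /cvgrPdist_lt/(_ e e0) := @cvg_id _ (nbhs z).
Qed.

Lemma dotq_cvg (T : Type) (F : set_system T) (FF : Filter F) (f : T -> H) e l :
  f @ F --> l -> (fun x => dotq e (f x)) @ F --> dotq e l.
Proof.
move=> /cvgrPdist_lt fl; apply/cvgrPdist_lt => eps eps0.
have e1 : 0 < `|e| + 1 by rewrite ltr_wpDl.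
near=> x; rewrite -dotqBr (le_lt_trans (dotq_le _ _))//.
have : `|l - f x| < eps / (`|e| + 1) by near: x; apply: fl; rewrite divr_gt0.
rewrite ltr_pdivlMr// => h; apply: le_lt_trans h.
by rewrite mulrC ler_wpM2l// lerDl.
Unshelve. all: by end_near. Qed.

Lemma slice_ptE I (z : R * R) : slice_pt I z = z.1 *: 1 + z.2 *: I.
Proof. by rewrite /slice_pt -scalerAr mulr1. Qed.

Lemma slice_pt_continuous I : continuous (slice_pt I : R * R -> H).
Proof.
move=> z; rewrite (_ : slice_pt I = fun z : R * R => z.1 *: 1 + z.2 *: I).
  by apply: cvgD; apply: cvgZr_tmp; [exact: cvg_fst|exact: cvg_snd].
by apply/funext => ?; exact: slice_ptE.
Qed.

Lemma dist_continuous a : continuous (fun w : H => `|w - a|).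
Proof.
move=> w; have h : (fun x : H => x - a) @ w --> w - a.
  apply: (@cvgB R H H (nbhs w) _ id (fun=> a)); first exact: cvg_id.
  exact: cvg_cst.
exact: (cvg_norm h).
Qed.

Lemma closed_dist_le a (rho : R) : closed [set w : H | `|w - a| <= rho].
Proof.
have /continuous_closedP := @dist_continuous a.
by move=> /(_ _ (@closed_le R rho)).
Qed.

(** L_I is the image of the plane under the continuous map [slice_pt I], and the
    preimage of a ball of radius [rho] about [a] lies in a square. *)
Lemma compact_line I a (rho : R) (C : set H) : unit_sphere I -> closed C ->
  compact [set w | [/\ line I w, `|w - a| <= rho & C w]].
Proof.
move=> I1 cC; pose B := `|a| + rho.
pose K2 : set (R * R) := `[- B, B]%classic `*` `[- B, B]%classic.
rewrite (_ : [set _ | _] =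
    slice_pt I @` K2 `&` ([set w | `|w - a| <= rho] `&` C)); last first.
  apply/seteqP; split=> [w|w] /=;
    [move=> [[z _ <-] za Cz]|move=> [[z _ <-] [za Cz]]]; split => //.
    exists z => //; have zB : `|slice_pt I z| <= B.
      rewrite -[slice_pt I z](subrK a) /B addrC.
      by rewrite (le_trans (ler_normD _ _))// lerD2l.
    have B0 : 0 <= B by exact: le_trans zB.
    have : `|slice_pt I z| ^+ 2 <= B ^+ 2 by rewrite lerXn2r ?nnegrE.
    rewrite norm_slice_pt// => h.
    have g (x : R) : x ^+ 2 <= B ^+ 2 -> - B <= x <= B.
      move=> xB; rewrite -ler_norml -(@ler_pXn2r _ 2)// ?nnegrE//.
      by rewrite real_normK ?num_real.
    have := sqr_ge0 z.1; have := sqr_ge0 z.2 => z1 z2.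
    by split; rewrite /= in_itv/=; apply: g; lra.
  by exists z.
apply: compact_closedI.
  apply: continuous_compact.
    by apply: continuous_subspaceT; exact: slice_pt_continuous.
  by apply: compact_setX; exact: segment_compact.
apply: closedI => //.
exact: closed_dist_le.
Qed.

(** Strict differentiability: the increment is compared with [d] for both
    endpoints moving near [z]. This encodes continuous complex differentiability
    on L_I by one estimate, which is local, survives products and becomes
    uniform on compact sets by a covering argument. Left multiplication by [w' - w] is the complex scaling. *)
Definition slice_derivative I (f : H -> H) z d := forall e : R, 0 < e ->
  exists2 r : R, 0 < r & forall w w', line I w -> line I w' ->
    `|w - z| < r -> `|w' - z| < r ->
    `|f w' - f w - (w' - w) * d| <= e * `|w' - w|.

Definition slice_diff I (f : H -> H) z := exists d, slice_derivative I f z d.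

Lemma slice_diff_uniform I f (K : set H) : compact K ->
  (forall z, K z -> slice_diff I f z) -> forall e : R, 0 < e ->
  exists2 r : R, 0 < r & forall z, K z -> exists d, forall w w',
    line I w -> line I w' -> `|w - z| < r -> `|w' - z| < r ->
    `|f w' - f w - (w' - w) * d| <= e * `|w' - w|.
Proof.
move=> /compact_near_coveringP cK fK e e0.
pose P (r : R) z := exists d, forall w w',
    line I w -> line I w' -> `|w - z| < r -> `|w' - z| < r ->
    `|f w' - f w - (w' - w) * d| <= e * `|w' - w|.
have : \forall r \near 0^'+, K `<=` P r.
  apply: cK => z /fK[d /(_ e e0)[r r0 h]].
  near=> x s => /=; exists d => w w' Iw Iw' wx w'x; apply: h => //.
    rewrite -(subrK x w) -addrA (le_lt_trans (ler_normD _ _))//.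
    have : `|w - x| < r / 2.
      rewrite (lt_trans wx)//; near: s.
      by apply: nbhs_right_lt; rewrite divr_gt0.
    have : `|z - x| < r / 2 by near: x; apply: near_dist_lt; rewrite divr_gt0.
    by rewrite (distrC z x); lra.
  rewrite -(subrK x w') -addrA (le_lt_trans (ler_normD _ _))//.
  have : `|w' - x| < r / 2.
    rewrite (lt_trans w'x)//; near: s.
    by apply: nbhs_right_lt; rewrite divr_gt0.
  have : `|z - x| < r / 2 by near: x; apply: near_dist_lt; rewrite divr_gt0.
  by rewrite (distrC z x); lra.
move=> h; near (0 : R)^'+ => r; exists r => //.
exact: (near h r).
Unshelve. all: by end_near. Qed.

(** The primitive root exp(2 pi I / n): its powers equidistribute on the unit
    circle of L_I, with steps of length at most 2 pi / n. *)
Lemma line_unity_root I n : unit_sphere I -> (1 < n)%N -> exists u : H,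
  [/\ line I u, u ^+ n = 1, u != 1, `|u| = 1 & `|u - 1| <= 2 * pi / n%:R].
Proof.
move=> I1 n1.
have [t tE] : exists t : R, t = 2 * pi / n%:R by exists (2 * pi / n%:R).
have n0 : (0 : R) < n%:R by rewrite ltr0n ltnW.
have t0 : 0 < t by rewrite tE divr_gt0// mulr_gt0// pi_gt0.
pose u := slice_pt I (cos t, sin t).
have uk k : u ^+ k = slice_pt I (cos (k%:R * t), sin (k%:R * t)).
  elim: k => [|k IH].
    by rewrite mul0r cos0 sin0 expr0 slice_ptE scale1r scale0r addr0.
  rewrite exprSr IH slice_ptM//= -natr1 mulrDl mul1r cosD sinD.
  by congr slice_pt; congr pair; ring.
have nu1 : `|u - 1| ^+ 2 = (2 * sin (t / 2)) ^+ 2.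
  rewrite (_ : u - 1 = slice_pt I (cos t - 1, sin t)); last first.
    by rewrite /u !slice_ptE /= scalerBl scale1r addrAC.
  rewrite norm_slice_pt//=.
  have ht : t = (t / 2) *+ 2 by rewrite mulr2n; lra.
  rewrite [in LHS]ht cos_mulr2n sin_mulr2n cos2sin2 !mulr2n.
  have := cos2Dsin2 (t / 2); set c := cos _; set s := sin _ => h.
  by have := congr1 (fun x => 4 * s ^+ 2 * x) h; lra.
have t2 : 0 < t / 2 < pi.
  rewrite divr_gt0//= ltr_pdivrMr// tE ltr_pdivrMr// (mulrC 2).
  by rewrite ltr_pMr ?ltr1n// mulr_gt0 ?pi_gt0.
have s0 : 0 < sin (t / 2) by exact: sin_gt0_pi.
exists u; split.
- by exists (cos t, sin t).
- rewrite uk tE mulrC divfK ?gt_eqF// mulrC mulr_natr cos2pi sin2pi.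
  by rewrite slice_ptE scale1r scale0r addr0.
- apply/eqP => u1; move: nu1; rewrite u1 subrr normr0 expr0n/= => /esym/eqP.
  by rewrite sqrf_eq0 mulf_eq0 pnatr_eq0/= gt_eqF.
- apply/eqP; rewrite -(@eqrXn2 _ 2)// expr1n norm_slice_pt//=.
  by rewrite cos2Dsin2.
- rewrite -tE -(@ler_pXn2r _ 2) ?nnegrE ?(ltW t0)// nu1.
  rewrite lerXn2r ?nnegrE ?mulr_ge0 ?(ltW s0) ?(ltW t0)//.
  have [c _] : exists2 c, c \in `[0, t / 2]%R &
      sin (t / 2) - sin 0 = cos c * (t / 2 - 0).
    apply: (@MVT_segment R sin cos); first by case/andP: t2 => /ltW.
    by apply: continuous_subspaceT; exact: continuous_sin.
  rewrite sin0 !subr0 => ->.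
  have : cos c * (t / 2) <= 1 * (t / 2) by rewrite ler_pM2r ?cos_le1//; lra.
  by lra.
Qed.

(** * The mean value property on regular polygons *)

Lemma lineX I u k : unit_sphere I -> line I u -> line I (u ^+ k).
Proof.
move=> I1 Iu; elim: k => [|k IH]; first by rewrite expr0; exact: line1.
by rewrite exprS; exact: lineM.
Qed.

Lemma norm_quatX q k : `|q ^+ k| = `|q| ^+ k.
Proof.
elim: k => [|k IH]; first by rewrite !expr0 norm_quat1.
by rewrite !exprS norm_quatM IH.
Qed.

Lemma norm_sum_le n (F : nat -> H) (c : R) :
  (forall k, (k < n)%N -> `|F k| <= c) ->
  `|\sum_(0 <= k < n) F k| <= n%:R * c.
Proof.
move=> Fc; rewrite big_mkord (le_trans (ler_norm_sum _ _ _))//.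
apply: (@le_trans _ _ (\sum_(i < n) c)); first by apply: ler_sum => i _; exact: Fc.
by rewrite sumr_const card_ord mulr_natl.
Qed.

(** A mean value property in which Riemann sums replace the circle integral. Let
    W t k be the vertex z0 + t v u^k of a regular polygon, d k a derivative near
    it, and S the sum of the v u^k d k. Going once around the polygon, the
    increments of [f] cancel, while to first order they are t (u - 1) v u^k d k;
    hence S is small. But S is also the radial derivative of the sum A t of the
    values of [f] at the vertices, so A moves little from t = 0, where it equals
    n f z0, to t = 1. *)
Lemma discrete_mean I f z0 (r : R) : unit_sphere I -> line I z0 -> 0 <= r ->
  (forall z, line I z -> `|z - z0| <= r -> slice_diff I f z) ->
  forall e : R, 0 < e -> exists2 delta : R, 0 < delta &
  forall n u v, line I u -> u ^+ n = 1 -> u != 1 -> `|u| = 1 ->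
    `|u - 1| < delta -> line I v -> `|v| <= r ->
    `|\sum_(0 <= k < n) f (z0 + v * u ^+ k) - n%:R *: f z0| <= n%:R * e.
Proof.
move=> I1 Iz0 r0 fz e e0.
have r1 : 0 < r + 1 by rewrite ltr_wpDl.
pose K := [set w | [/\ line I w, `|w - z0| <= r & [set: H] w]].
have cK : compact K by apply: compact_line => //; exact: closedT.
(* r + 1 in place of r, since r = 0 is allowed. *)
pose e1 := e / (2 * (r + 1)).
have e10 : 0 < e1 by rewrite divr_gt0// mulr_gt0.
have fK z : K z -> slice_diff I f z by move=> [Iz zr _]; exact: fz.
have [d0 d00 unif] := slice_diff_uniform cK fK e10.
exists (d0 / (r + 1)) => [|n u v Iu un u1 nu ud Iv vr]; first by rewrite divr_gt0.
pose V k := v * u ^+ k.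
pose W (t : R) k := z0 + t *: V k.
have IV k : line I (V k) by apply: lineM => //; exact: lineX.
have nV k : `|V k| = `|v| by rewrite norm_quatM norm_quatX nu expr1n mulr1.
have IW t k : line I (W t k) by apply: lineD => //; exact: lineZ.
have KW (t : R) k : 0 <= t <= 1 -> K (W t k).
  move=> /andP[t0 t1]; split => //; rewrite /W addrC addKr normrZ nV ger0_norm//.
  by rewrite (le_trans _ vr)// ler_piMl.
pose A (t : R) := \sum_(0 <= k < n) f (W t k).
have step (t t' : R) : 0 < t <= 1 -> `|t' - t| * (r + 1) < d0 ->
    `|A t' - A t| <= `|t' - t| * (n%:R * (2 * e1 * `|v|)).
  move=> /andP[t0 t1] tt'.
  have /choice[d hd] : forall k, exists d, forall w w',
      line I w -> line I w' -> `|w - W t k| < d0 -> `|w' - W t k| < d0 ->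
      `|f w' - f w - (w' - w) * d| <= e1 * `|w' - w|.
    by move=> k; apply/unif/KW; rewrite (ltW t0).
  pose S := \sum_(0 <= k < n) V k * d k.
  have WS k : W t k.+1 - W t k = t *: (V k * (u - 1)).
    rewrite /W opprD addrACA subrr add0r -scalerBr mulrBr mulr1.
    by rewrite /V exprSr mulrA.
  have Ssmall : `|S| <= n%:R * (e1 * `|v|).
    (* Angular increments, between consecutive vertices. *)
    have ang k : `|f (W t k.+1) - f (W t k) - (W t k.+1 - W t k) * d k| <=
        e1 * (t * `|v| * `|u - 1|).
      have nW : `|W t k.+1 - W t k| = t * `|v| * `|u - 1|.
        by rewrite WS normrZ norm_quatM nV gtr0_norm// mulrA.
      rewrite -nW; apply: hd => //; first by rewrite subrr normr0.
      rewrite nW; apply: le_lt_trans (_ : (r + 1) * `|u - 1| < d0); last first.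
        by rewrite mulrC -ltr_pdivlMr.
      apply: ler_wpM2r => //; apply: le_trans (_ : 1 * `|v| <= _).
        exact: ler_wpM2r.
      by rewrite mul1r (le_trans vr)// lerDl.
    have tel : \sum_(0 <= k < n) (f (W t k.+1) - f (W t k)) = 0.
      rewrite (telescope_sumr (fun k => f (W t k)))// /W /V un expr0 subrr//.
    have sumE : \sum_(0 <= k < n) (W t k.+1 - W t k) * d k = t *: ((u - 1) * S).
      rewrite mulr_sumr scaler_sumr; apply: eq_bigr => k _.
      rewrite WS -scalerAl; congr (_ *: _); rewrite mulrA; congr (_ * _).
      by apply: (@lineC I) => //; apply: lineB => //; exact: line1.
    have : `|t *: ((u - 1) * S)| <= n%:R * (e1 * (t * `|v| * `|u - 1|)).
      rewrite -sumE -normrN -[- _]add0r -[X in X - _]tel -sumrB.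
      exact: norm_sum_le.
    rewrite normrZ norm_quatM gtr0_norm//.
    rewrite [leRHS](_ : _ = t * (`|u - 1| * (n%:R * (e1 * `|v|)))); last ring.
    by rewrite !ler_pM2l// normr_gt0 subr_eq0.
  (* Radial increments, at a fixed vertex. *)
  have rad k : `|f (W t' k) - f (W t k) - (t' - t) *: (V k * d k)| <=
      e1 * (`|t' - t| * `|v|).
    have nW : W t' k - W t k = (t' - t) *: V k.
      by rewrite /W opprD addrACA subrr add0r -scalerBl.
    have -> : `|t' - t| * `|v| = `|W t' k - W t k| by rewrite nW normrZ nV.
    rewrite scalerAl -nW; apply: hd => //; first by rewrite subrr normr0.
    rewrite nW normrZ nV; apply: le_lt_trans tt'; apply: ler_wpM2l => //.
    by rewrite (le_trans vr)// lerDl.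
  have -> : A t' - A t = (t' - t) *: S +
      \sum_(0 <= k < n) (f (W t' k) - f (W t k) - (t' - t) *: (V k * d k)).
    rewrite /A -sumrB scaler_sumr -big_split /=.
    by apply: eq_bigr => k _; rewrite addrC subrK.
  rewrite (le_trans (ler_normD _ _))//.
  have : `|(t' - t) *: S| <= `|t' - t| * (n%:R * (e1 * `|v|)).
    by rewrite normrZ; exact: ler_wpM2l.
  have : `|\sum_(0 <= k < n) (f (W t' k) - f (W t k) - (t' - t) *: (V k * d k))|
      <= n%:R * (e1 * (`|t' - t| * `|v|)).
    exact: norm_sum_le.
  by lra.
pose m := (Num.truncn ((r + 1) / d0)).+1.
have m0 : (0 : R) < m%:R by rewrite ltr0n.
have mlt : (r + 1) < d0 * m%:R.
  by rewrite -ltr_pdivrMl// mulrC; exact: truncnS_gt.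
have A0 : A 0 = n%:R *: f z0.
  rewrite /A (eq_bigr (fun=> f z0)) => [|k _]; last by rewrite /W scale0r addr0.
  by rewrite sumr_const_nat subn0 scaler_nat.
have -> : \sum_(0 <= k < n) f (z0 + v * u ^+ k) = A 1.
  by apply: eq_bigr => k _; rewrite /W scale1r.
pose B j := A (j%:R / m%:R).
have B0 : B 0%N = A 0 by rewrite /B mul0r.
have Bm : B m = A 1 by rewrite /B divff// gt_eqF.
have Bstep j : (j < m)%N ->
    `|B j.+1 - B j| <= m%:R^-1 * (n%:R * (2 * e1 * `|v|)).
  move=> jm; have d : `|j%:R / m%:R - j.+1%:R / m%:R : R| = m%:R^-1.
    by rewrite -natr1 mulrDl mul1r opprD addrA subrr add0r normrN ger0_norm//.
  rewrite distrC -d; apply: step.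
    rewrite divr_gt0 ?ltr0n//= ler_pdivrMr// mul1r ler_nat//.
  by rewrite d mulrC ltr_pdivrMr.
rewrite -A0 -Bm -B0 -(telescope_sumr (fun j => B j))//.
rewrite (le_trans (norm_sum_le Bstep))// mulVKf ?gt_eqF//.
apply: ler_wpM2l => //.
have -> : 2 * e1 * `|v| = e * (`|v| / (r + 1)).
  by rewrite /e1; field; rewrite gt_eqF.
rewrite ler_piMr ?(ltW e0)// ler_pdivrMr// mul1r (le_trans vr)// lerDl//.
Qed.

(** * The strong maximum principle *)

Lemma dotq_sum c n (F : nat -> H) :
  dotq c (\sum_(0 <= k < n) F k) = \sum_(0 <= k < n) dotq c (F k).
Proof.
by apply: (big_morph (dotq c) (dotqDr c)); rewrite /dotq /= !mulr0 !addr0.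
Qed.

Lemma slice_diff_continuous I f z : line I z -> slice_diff I f z ->
  forall e : R, 0 < e -> exists2 r : R, 0 < r &
    forall w, line I w -> `|w - z| < r -> `|f w - f z| < e.
Proof.
move=> Iz [d /(_ 1 ltr01)[r r0 h]] e e0.
have d1 : 0 < 1 + `|d| by rewrite ltr_pwDl.
exists (Num.min r (e / (1 + `|d|))) => [|w Iw].
  by rewrite lt_min r0 divr_gt0.
rewrite lt_min => /andP[wr we]; apply: le_lt_trans (_ : `|w - z| * (1 + `|d|) < _).
  have := h z w Iz Iw; rewrite subrr normr0 => /(_ r0 wr) h1.
  rewrite -[f w - f z](subrK ((w - z) * d)) (le_trans (ler_normD _ _))//.
  by rewrite mulrDr mulr1 norm_quatM lerD2r; rewrite mul1r in h1.
by rewrite -ltr_pdivlMr.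
Qed.

Lemma norm_subX1 (u : H) k : `|u| = 1 -> `|u ^+ k - 1| <= k%:R * `|u - 1|.
Proof.
move=> nu; elim: k => [|k IH]; first by rewrite expr0 subrr normr0 mul0r.
rewrite (_ : u ^+ k.+1 - 1 = u ^+ k * (u - 1) + (u ^+ k - 1)); last first.
  by rewrite exprSr mulrBr mulr1 addrA subrK.
rewrite (le_trans (ler_normD _ _))// norm_quatM norm_quatX nu expr1n mul1r.
by rewrite -natr1 mulrDl mul1r addrC lerD2r.
Qed.

(** With c = f z0 the maximal value in modulus, |f z - c|^2 is at most
    2 <c, c - f z>, whose sum over a regular polygon is small by the mean value
    property. If f w differs from c, then a fixed proportion 1 / N of the
    vertices of a fine polygon through w lies so close to w that |f - c| exceeds
    |f w - c| / 2 there, and these vertices alone make the sum too large. *)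
Lemma slice_strong_max I f z0 (r : R) : unit_sphere I -> line I z0 ->
  (forall z, line I z -> `|z - z0| <= r -> slice_diff I f z) ->
  (forall z, line I z -> `|z - z0| <= r -> `|f z| <= `|f z0|) ->
  forall z, line I z -> `|z - z0| <= r -> f z = f z0.
Proof.
move=> I1 Iz0 fz fmax w Iw wr; apply/eqP/negPn/negP => fw.
have r0 : 0 <= r by exact: le_trans wr.
set c := f z0 in fmax fw *.
have eta0 : 0 < `|f w - c| by rewrite normr_gt0 subr_eq0.
set eta := `|f w - c| in eta0.
have [d1 d10 fcont] := slice_diff_continuous Iw (fz w Iw wr)
  (divr_gt0 eta0 (ltr0Sn R 1)).
have pi0 : 0 < 2 * pi :> R by rewrite mulr_gt0// pi_gt0.
pose N := (Num.truncn (r * (2 * pi) / d1)).+1.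
have N0 : (0 : R) < N%:R by rewrite ltr0n.
have Nd : r * (2 * pi) < d1 * N%:R.
  by rewrite -ltr_pdivrMl// mulrC; exact: truncnS_gt.
have c1 : 0 < `|c| + 1 by rewrite ltr_wpDl.
(* Chosen so that 2 |c| n e < m (eta / 2)^2 when n = N m. *)
pose e := eta ^+ 2 / (16 * (`|c| + 1) * N%:R).
have e0 : 0 < e by rewrite divr_gt0 ?exprn_gt0// !mulr_gt0.
have [del del0 mean] := discrete_mean I1 Iz0 r0 fz e0.
pose m := (Num.truncn (2 * pi / del)).+2.
have m0 : (0 : R) < m%:R by rewrite ltr0n.
have md : 2 * pi < del * m%:R.
  rewrite -ltr_pdivrMl// mulrC; apply: lt_trans (truncnS_gt _) _.
  by rewrite ltr_nat.
pose n := (N * m)%N.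
have n1 : (1 < n)%N by rewrite /n mulSn ltn_addr.
have nE : n%:R = N%:R * m%:R :> R by rewrite natrM.
have [u [Iu un u1 nu ud]] := line_unity_root I1 n1.
pose v := w - z0.
have Iv : line I v by exact: lineB.
pose W k := z0 + v * u ^+ k.
have IW k : line I (W k) by apply/lineD/lineM => //; exact: lineX.
have Wr k : `|W k - z0| <= r.
  by rewrite /W addrC addKr norm_quatM norm_quatX nu expr1n mulr1.
have udel : `|u - 1| < del.
  apply: le_lt_trans ud _; rewrite nE ltr_pdivrMr ?mulr_gt0//.
  apply: lt_le_trans md _; rewrite ler_wpM2l ?(ltW del0)//.
  by rewrite ler_peMl ?(ltW m0)// ler1n.
have := mean n u v Iu un u1 nu udel Iv wr => {}mean.
have upper : \sum_(0 <= k < n) `|f (W k) - c| ^+ 2 <= 2 * `|c| * (n%:R * e).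
  apply: (@le_trans _ _ (2 * dotq c (n%:R *: c - \sum_(0 <= k < n) f (W k)))).
    have -> : n%:R *: c = \sum_(0 <= k < n) c.
      by rewrite sumr_const_nat subn0 scaler_nat.
    rewrite -sumrB dotq_sum mulr_sumr !big_mkord; apply: ler_sum => k _.
    rewrite distrC sqr_normB dotqBr dotqq.
    have : `|f (W k)| ^+ 2 <= `|c| ^+ 2 by rewrite lerXn2r ?nnegrE// fmax.
    by lra.
  rewrite -mulrA ler_pM2l//; apply: le_trans (ler_norm _) _.
  apply: le_trans (dotq_le _ _) _; apply: ler_wpM2l => //.
  by rewrite distrC.
have lower : m%:R * (eta / 2) ^+ 2 <= \sum_(0 <= k < n) `|f (W k) - c| ^+ 2.
  rewrite (big_cat_nat (n := m))//=; last by rewrite /n leq_pmull.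
  rewrite ler_wpDr ?sumr_ge0//.
  apply: (@le_trans _ _ (\sum_(0 <= k < m) (eta / 2) ^+ 2)).
    by rewrite sumr_const_nat subn0 mulr_natl.
  rewrite !big_mkord; apply: ler_sum => k _.
  rewrite lerXn2r ?nnegrE ?divr_ge0 ?(ltW eta0)//.
  have : `|f (W k) - f w| < eta / 2.
    apply: fcont => //.
    have -> : W k - w = v * (u ^+ k - 1).
      by rewrite mulrBr mulr1 /W [in RHS]/v opprB addrCA addrA.
    rewrite norm_quatM; apply: le_lt_trans (_ : r * (m%:R * (2 * pi / n%:R)) < _).
      apply: ler_pM => //; apply: le_trans (norm_subX1 _ nu) _.
      by apply: ler_pM => //; rewrite ler_nat ltnW.
    rewrite nE (_ : r * _ = r * (2 * pi) / N%:R); last first.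
      by field; rewrite !gt_eqF.
    by rewrite ltr_pdivrMr.
  have : eta <= `|f w - f (W k)| + `|f (W k) - c|.
    by rewrite /eta -[f w - c](subrKA (f (W k))) ler_normD.
  by rewrite (distrC (f w)); lra.
have := le_trans lower upper.
rewrite nE leNgt => /negP; apply.
have -> : 2 * `|c| * (N%:R * m%:R * e) =
    m%:R * (eta ^+ 2 * (`|c| / (`|c| + 1)) / 8).
  by rewrite /e; field; rewrite !gt_eqF.
rewrite ltr_pM2l//.
have : `|c| / (`|c| + 1) < 1 by rewrite ltr_pdivrMr// mul1r ltrDl.
have : 0 < eta ^+ 2 by rewrite exprn_gt0.
set x := eta ^+ 2; set y := _ / _ => x0 y1.
have : x * y < x * 1 by rewrite ltr_pM2l.
by rewrite exprMn -/x exprVn; lra.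
Qed.

(** * The maximum principle on compact sets *)

Lemma slice_diff_norm_continuous I f (K : set H) : K `<=` line I ->
  (forall z, K z -> slice_diff I f z) -> {within K, continuous (fun w => `|f w|)}.
Proof.
move=> KI fK; apply/subspace_continuousP => z Kz; apply/cvgrPdist_lt => e e0.
have [r r0 h] := slice_diff_continuous (KI _ Kz) (fK _ Kz) e0.
rewrite near_withinE; near=> w => Kw /=; apply: le_lt_trans (_ : `|f w - f z| < e).
  by rewrite distrC ler_dist_dist.
apply: h; first exact: KI.
by rewrite distrC; near: w; exact: near_dist_lt.
Unshelve. all: by end_near. Qed.

Lemma dotq_continuous q : continuous (dotq q : H -> R).
Proof. by move=> w; exact: (@dotq_cvg _ (nbhs w) _ id q w (@cvg_id _ _)). Qed.

(** Among the points of [K] where |f| is maximal, take one with the largest real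
    part. If it were interior, then |f| would be maximal on a whole disc around
    it, which contains points with a larger real part. *)
Lemma slice_weak_max I f (K : set H) (M : R) : unit_sphere I ->
  K `<=` line I -> compact K -> (forall z, K z -> slice_diff I f z) ->
  (forall z, K z -> `|f z| <= M \/
    exists2 r : R, 0 < r & forall w, line I w -> `|w - z| <= r -> K w) ->
  forall z, K z -> `|f z| <= M.
Proof.
move=> I1 KI cK fK bd z Kz; rewrite leNgt; apply/negP => Mz.
have cf := slice_diff_norm_continuous KI fK.
have [c /set_mem Kc cmax] := compact_EVT_max (ex_intro _ z Kz) cK cf.
pose E := K `&` [set w | `|f c| <= `|f w|].
have cE : compact E.
  have /continuous_closedP/(_ _ (@closed_ge R `|f c|)) := cf.
  move=> /closed_subspaceP[V cV VK].
  rewrite /E setIC -[X in compact X]VK setIC.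
  exact: compact_closedI.
have cq1 : {within E, continuous (fun w : H => dotq 1 w)}.
  exact/continuous_subspaceT/dotq_continuous.
have Ec : E c by split => /=.
have [t /set_mem[Kt ft] tmax] := compact_EVT_max (ex_intro _ c Ec) cE cq1.
have ftc : `|f t| = `|f c|.
  by apply/eqP; rewrite eq_le ft cmax//; exact/mem_set.
have [|[r r0 rK]] := bd _ Kt.
  by rewrite ftc leNgt (lt_le_trans Mz)// cmax//; exact/mem_set.
have It := KI _ Kt.
have fr : forall w, line I w -> `|w - t| <= r -> f w = f t.
  apply: slice_strong_max => // w Iw wr; first exact/fK/rK.
  by rewrite ftc cmax//; apply/mem_set/rK.
pose w := t + r%:A.
have Iw : line I w by apply: lineD => //; exact: line_real.
have wr : `|w - t| <= r.
  by rewrite /w addrC addKr normrZ norm_quat1 mulr1 gtr0_norm.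
have : dotq 1 w <= dotq 1 t.
  by apply/tmax/mem_set; split => /=; [exact: rK|rewrite (fr w)// ftc].
rewrite dotqDr dotqZr /dotq /= !mulr0 !addr0 !mulr1 gerDl.
by rewrite leNgt r0.
Qed.

(** The product rule for 1 / (w - a), whose values commute with the increments
    w' - w because both lie in L_I. *)
Lemma slice_diff_invM I f z a : unit_sphere I -> line I z -> line I a ->
  z != a -> slice_diff I f z -> slice_diff I (fun w => quatV (w - a) * f w) z.
Proof.
move=> I1 Iz Ia za [d fd].
pose k w := quatV (w - a).
exists (k z * d - k z * k z * f z) => e e0.
have za0 : 0 < `|z - a| by rewrite normr_gt0 subr_eq0.
pose B := 2 / `|z - a|.
have B0 : 0 < B by rewrite divr_gt0.
have [r1 r10 h1] := fd _ (divr_gt0 e0 (mulr_gt0 (ltr0Sn R 1) B0)).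
have [r2 r20 h2] := fd 1 ltr01.
(* [C * r] bounds the cofactor [P] below on the ball of radius [r]. *)
pose C := B ^+ 2 * `|d| + B ^+ 2 * (1 + `|d|) + 2 * B ^+ 3 * `|f z|.
have C0 : 0 <= C by rewrite !addr_ge0 ?mulr_ge0 ?addr_ge0 ?exprn_ge0 ?(ltW B0).
have Cp : 0 < C + 1 by rewrite ltr_wpDl.
have C1 : 0 < 2 * (C + 1) by rewrite mulr_gt0.
pose r := Num.min (Num.min r1 r2) (Num.min (`|z - a| / 2) (e / (2 * (C + 1)))).
have r0 : 0 < r by rewrite !lt_min r10 r20 !divr_gt0.
have rE w : `|w - z| < r -> [/\ `|w - z| < r1, `|w - z| < r2,
    `|w - z| < `|z - a| / 2 & `|w - z| < r].
  move=> wr; split => //; move: wr; rewrite !lt_min.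
  - by case/andP => /andP[].
  - by case/andP => /andP[].
  - by case/andP => _ /andP[].
have rC : C * r <= e / 2.
  apply: (@le_trans _ _ (C * (e / (2 * (C + 1))))).
    by apply: ler_wpM2l => //; rewrite !ge_min lexx !orbT.
  rewrite (_ : C * _ = e / 2 * (C / (C + 1))); last by field; rewrite gt_eqF.
  by rewrite ler_piMr ?divr_ge0 ?(ltW e0)// ler_pdivrMr// mul1r lerDl.
have wa w : `|w - z| < `|z - a| / 2 -> w - a != 0 /\ `|k w| <= B.
  move=> wz; have h : `|z - a| / 2 <= `|w - a|.
    have : `|z - a| <= `|z - w| + `|w - a| by rewrite ler_distD.
    by rewrite (distrC z w); lra.
  have w0 : w - a != 0 by rewrite -normr_gt0; lra.
  split => //; rewrite /k norm_quatV// /B -[leRHS]invrK invfM invrK.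
  by rewrite lef_pV2 ?posrE ?normr_gt0 ?mulr_gt0// mulrC.
have kB w w' : line I w -> line I w' -> `|w - z| < `|z - a| / 2 ->
    `|w' - z| < `|z - a| / 2 -> k w' - k w = - ((w' - w) * (k w' * k w)).
  move=> Iw Iw' /wa[w0 _] /wa[w'0 _].
  have Ik : line I (k w) by apply: lineV => //; exact: lineB.
  have Ik' : line I (k w') by apply: lineV => //; exact: lineB.
  have -> : w' - w = (w' - a) - (w - a) by rewrite opprB addrA subrK.
  rewrite mulrBl mulrA mulqV// mul1r (lineC I1 Ik' Ik) mulrA mulqV// mul1r.
  by rewrite opprB.
exists r => // w w' Iw Iw' wr w'r.
have [wr1 wr2 wza _] := rE _ wr; have [w'r1 w'r2 w'za _] := rE _ w'r.
have [w0 kw] := wa _ wza; have [w'0 kw'] := wa _ w'za.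
have zz : `|z - z| < `|z - a| / 2 by rewrite subrr normr0 divr_gt0.
have [_ kz] := wa _ zz.
have Ik' : line I (k w') by apply: lineV => //; exact: lineB.
have kd v : line I v -> `|v - z| < r -> `|k v - k z| <= B ^+ 2 * r.
  move=> Iv vr; have [_ _ vza _] := rE _ vr; have [_ kv] := wa _ vza.
  rewrite kB// normrN !norm_quatM mulrC; apply: ler_pM; rewrite ?mulr_ge0//.
    by rewrite expr2; apply: ler_pM.
  exact: ltW.
pose P := (k w' - k z) * d - k w' * k w * (f w - f z)
  - (k w' * (k w - k z) + (k w' - k z) * k z) * f z.
have -> : k w' * f w' - k w * f w - (w' - w) * (k z * d - k z * k z * f z)
    = k w' * (f w' - f w - (w' - w) * d) + (w' - w) * P.
  have e1 : k w * f w = k w' * f w + (w' - w) * (k w' * k w * f w).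
    have := kB w w' Iw Iw' wza w'za => /(congr1 ( *%R^~ (f w))).
    rewrite mulrBl mulNr mulrA => /eqP; rewrite subr_eq => /eqP ->.
    by rewrite !mulrA addrAC addNr add0r.
  have e2 : k w' * ((w' - w) * d) = (w' - w) * (k w' * d).
    by rewrite !mulrA (lineC I1 Ik' (lineB Iw' Iw)).
  rewrite [in RHS]mulrBr e2 e1 /P.
  move: (w' - w) (k w') (k w) (k z) (f w) (f w') (f z) => D k1 k2 k0 f2 f1 f0.
  by apply: quat_eq => /=; ring.
rewrite (le_trans (ler_normD _ _))// !norm_quatM.
have P1 : `|P| <= e / 2.
  apply: le_trans rC; rewrite /P (le_trans (ler_normB _ _))//.
  have p1 : `|(k w' - k z) * d| <= B ^+ 2 * r * `|d|.
    by rewrite norm_quatM ler_wpM2r// kd.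
  have p2 : `|k w' * k w * (f w - f z)| <= B ^+ 2 * (r * (1 + `|d|)).
    rewrite !norm_quatM; apply: ler_pM; rewrite ?mulr_ge0//.
      by rewrite expr2; apply: ler_pM.
    have := h2 z w Iz Iw; rewrite subrr normr0 mul1r => /(_ r20 wr2) h.
    apply: le_trans (_ : `|w - z| * (1 + `|d|) <= _); last first.
      by rewrite ler_wpM2r ?addr_ge0// ltW.
    rewrite -[f w - f z](subrK ((w - z) * d)) (le_trans (ler_normD _ _))//.
    by rewrite mulrDr mulr1 norm_quatM lerD2r.
  have p3 : `|(k w' * (k w - k z) + (k w' - k z) * k z) * f z| <=
      2 * (B * (B ^+ 2 * r)) * `|f z|.
    rewrite norm_quatM ler_wpM2r// (le_trans (ler_normD _ _))// !norm_quatM.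
    have : `|k w'| * `|k w - k z| <= B * (B ^+ 2 * r).
      by apply: ler_pM => //; exact: kd.
    have : `|k w' - k z| * `|k z| <= B ^+ 2 * r * B.
      by apply: ler_pM => //; exact: kd.
    by lra.
  have := ler_normB ((k w' - k z) * d) (k w' * k w * (f w - f z)).
  by move: p1 p2 p3; rewrite /C; lra.
have : `|k w'| * `|f w' - f w - (w' - w) * d| <= B * (e / (2 * B) * `|w' - w|).
  by apply: ler_pM => //; exact: h1.
rewrite (_ : B * _ = e / 2 * `|w' - w|); last by field; rewrite gt_eqF.
have : `|w' - w| * `|P| <= `|w' - w| * (e / 2) by exact: ler_wpM2l.
by lra.
Qed.

(** * Unique continuation *)

(** The source of all uniqueness statements. The weak maximum principle applied
    to (z - a)^(-n) f sees only the boundary points of [K] at distance [rho] from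
    [a], since [f] vanishes at the others; it gives
    |f z| <= M (|z - a| / rho)^n for every n, where M bounds |f| on [K]. *)
Lemma slice_vanish I f a (rho : R) (K : set H) : unit_sphere I -> line I a ->
  0 < rho -> K `<=` line I -> compact K -> (forall z, K z -> slice_diff I f z) ->
  ~ K a -> (forall z, K z -> `|z - a| <= rho) ->
  (forall z, K z -> `|z - a| < rho -> f z = 0 \/
    exists2 r : R, 0 < r & forall w, line I w -> `|w - z| <= r -> K w) ->
  forall z, K z -> `|z - a| < rho -> f z = 0.
Proof.
move=> I1 Ia rho0 KI cK fK Ka Krho bd z Kz zrho.
have cf := slice_diff_norm_continuous KI fK.
have [c /set_mem Kc cmax] := compact_EVT_max (ex_intro _ z Kz) cK cf.
set M := `|f c| in cmax.
have Kneq w : K w -> w != a by move=> Kw; apply: contra_notN Ka => /eqP <-.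
have Kpos w : K w -> 0 < `|w - a|.
  by move=> Kw; rewrite normr_gt0 subr_eq0; exact: Kneq.
pose h n w := quatV (w - a) ^+ n * f w.
have hd n w : K w -> slice_diff I (h n) w.
  move=> Kw; elim: n => [|n IH].
    rewrite (_ : h 0%N = f); first exact: fK.
    by apply/funext => x; rewrite /h expr0 mul1r.
  rewrite (_ : h n.+1 = fun x => quatV (x - a) * h n x); last first.
    by apply/funext => x; rewrite /h exprS mulrA.
  by apply: slice_diff_invM => //; [exact: KI|exact: Kneq].
have nh n w : K w -> `|h n w| = `|f w| / `|w - a| ^+ n.
  move=> Kw; rewrite norm_quatM norm_quatX norm_quatV ?exprVn 1?mulrC//.
  by rewrite subr_eq0; exact: Kneq.
have hle n w : K w -> `|h n w| <= M / rho ^+ n.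
  move: w; apply: (slice_weak_max I1 KI cK (hd n)) => w Kw.
  have [wrho|wrho] := ltP `|w - a| rho; last first.
    left; rewrite nh//; have -> : `|w - a| = rho.
      by apply/eqP; rewrite eq_le wrho Krho.
    by rewrite ler_wpM2r ?invr_ge0 ?exprn_ge0 ?(ltW rho0)// cmax//; exact/mem_set.
  have [fw0|?] := bd w Kw wrho; last by right.
  by left; rewrite nh// fw0 normr0 mul0r divr_ge0 ?exprn_ge0 ?(ltW rho0)// /M.
have fle n : `|f z| <= M * (`|z - a| / rho) ^+ n.
  have := hle n z Kz; rewrite nh// ler_pdivrMr ?exprn_gt0 ?Kpos//.
  by rewrite exprMn exprVn mulrA mulrAC.
apply/eqP; rewrite -normr_le0.
have q1 : `|(`|z - a| / rho)| < 1.
  by rewrite ger0_norm ?divr_ge0 ?(ltW rho0)// ltr_pdivrMr// mul1r.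
have lim : (fun n => M * (`|z - a| / rho) ^+ n) @ \oo --> (0 : R).
  exact: cvg_geometric.
apply: (ler_cvg_to (@cvg_cst _ _ _ _ _) lim).
by near=> n; exact: fle.
Unshelve. all: by end_near. Qed.

Lemma slice_diffBc I f c z : slice_diff I f z -> slice_diff I (fun w => f w - c) z.
Proof.
move=> [d fd]; exists d => e /fd[r r0 h]; exists r => // w w' Iw Iw' wr w'r.
by rewrite opprB addrA subrK; exact: h.
Qed.

(** Unique continuation from a small disc to a larger concentric one: apply
    [slice_vanish] to a closed annulus whose inner boundary lies in the small
    disc. *)
Lemma slice_const_disc I f c z0 (e rho : R) : unit_sphere I -> line I z0 ->
  (forall z, line I z -> `|z - z0| <= rho -> slice_diff I f z) ->
  0 < e -> (forall z, line I z -> `|z - z0| < e -> f z = c) ->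
  forall z, line I z -> `|z - z0| < rho -> f z = c.
Proof.
move=> I1 Iz0 fd e0 fc z Iz zrho.
have [/fc->//|ez] := ltP `|z - z0| e.
apply/eqP; rewrite -subr_eq0; apply/eqP.
have cC : closed [set w : H | e / 2 <= `|w - z0|].
  have /continuous_closedP := @dist_continuous z0.
  by move=> /(_ _ (@closed_ge R (e / 2))).
have cK := compact_line (a := z0) (rho := rho) I1 cC.
apply: (@slice_vanish I (fun w => f w - c) z0 rho _ I1 Iz0 _ _ cK) => //.
- by apply: le_lt_trans zrho.
- by move=> w [].
- by move=> w [Iw wrho _]; apply: slice_diffBc; exact: fd.
- by move=> [_ _ /=]; rewrite subrr normr0 leNgt divr_gt0.
- by move=> w [].
- move=> w [Iw _ _] wrho; have [we|we] := ltP `|w - z0| e.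
    by left; rewrite fc// subrr.
  right; exists (Num.min (rho - `|w - z0|) (e / 2)).
    by rewrite lt_min subr_gt0 wrho divr_gt0.
  move=> w' Iw'; rewrite le_min => /andP[w'1 w'2].
  have t1 : `|w' - z0| <= `|w' - w| + `|w - z0| by exact: ler_distD.
  have t2 : `|w - z0| <= `|w - w'| + `|w' - z0| by exact: ler_distD.
  rewrite (distrC w w') in t2.
  by split => //=; lra.
- by split => //=; lra.
Qed.

Lemma dotq_slice_pt I (x : R * R) : unit_sphere I -> dotq I (slice_pt I x) = x.2.
Proof.
move=> /unit_sphereP[I0 I1]; rewrite /dotq /= !I0.
by have := congr1 (fun t => t * x.2) I1 => /= I1'; lra.
Qed.

(** Unique continuation from a real interval into a half-plane: apply
    [slice_vanish] to the lens cut out of L_I by the closed upper half-plane and a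
    disc whose centre [a] lies slightly below the interval. The flat side of the
    lens is in the interval. *)
Lemma slice_const_real I f c (x0 r : R) : unit_sphere I -> 0 < r ->
  (forall z, line I z -> `|z - x0%:A| <= r -> slice_diff I f z) ->
  (forall x : R, `|x - x0| <= r -> f x%:A = c) ->
  let z0 := slice_pt I (x0, r / 8) in
  forall z, line I z -> `|z - z0| < r / 8 -> f z = c.
Proof.
move=> I1 r0 fd fc z0 z Iz zz0.
have nI : `|I| = 1 by exact: norm_unit.
apply/eqP; rewrite -subr_eq0; apply/eqP.
(* The disc of radius r / 2 about [a] stays within r of x0, and it contains the
   disc of radius r / 8 about [z0]: r / 8 + (r / 8 + r / 4) = r / 2. *)
pose a := slice_pt I (x0, - (r / 4)).
have aE : x0%:A = a + (r / 4) *: I.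
  by rewrite /a slice_ptE /= scaleNr subrK.
have zE : z0 = x0%:A + (r / 8) *: I by rewrite /z0 slice_ptE.
have cC : closed [set w : H | 0 <= dotq I w].
  have /continuous_closedP := @dotq_continuous I.
  by move=> /(_ _ (@closed_ge R 0)).
have cK := compact_line (a := a) (rho := r / 2) I1 cC.
have near_x0 w : `|w - a| <= r / 2 -> `|w - x0%:A| <= r.
  move=> wa; rewrite aE opprD addrA (le_trans (ler_normB _ _))//.
  by rewrite normrZ nI mulr1 gtr0_norm ?divr_gt0//; lra.
have dot1 w w' : dotq I w - `|w' - w| <= dotq I w'.
  have := dotq_le I (w' - w); rewrite nI mul1r dotqBr ler_norml => /andP[? _].
  by lra.
have Ia : line I a by exists (x0, - (r / 4)).
have t1 : `|z - a| <= `|z - z0| + `|z0 - a| by exact: ler_distD.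
have t2 : `|z0 - a| = r / 8 + r / 4.
  rewrite zE aE [X in `|X|]addrC -addrA addKr -scalerDl normrZ nI mulr1.
  by rewrite ger0_norm ?addr_ge0 ?divr_ge0 ?(ltW r0)// addrC.
apply: (@slice_vanish I (fun w => f w - c) a (r / 2) _ I1 Ia _ _ cK) => //.
- by rewrite divr_gt0.
- by move=> w [].
- by move=> w [Iw wa _]; apply/slice_diffBc/fd => //; exact: near_x0.
- by move=> [_ _ /=]; rewrite dotq_slice_pt//= oppr_ge0 leNgt divr_gt0.
- by move=> w [].
- move=> w [Iw wa /= w0] wlt.
  move: w0; rewrite le_eqVlt => /orP[/eqP w0|w0].
    left; case: Iw wa w0 {wlt} => x _ <- /near_x0.
    rewrite dotq_slice_pt// => wx x2.
    have xE : slice_pt I x = x.1%:A by rewrite slice_ptE -x2 scale0r addr0.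
    rewrite xE fc ?subrr//; move: wx.
    by rewrite xE -scalerBl normrZ norm_quat1 mulr1.
  right; exists (Num.min (r / 2 - `|w - a|) (dotq I w)).
    by rewrite lt_min subr_gt0 wlt.
  move=> w' Iw'; rewrite le_min => /andP[w'1 w'2].
  have t3 : `|w' - a| <= `|w' - w| + `|w - a| by exact: ler_distD.
  by split => //=; [lra|have := dot1 w w'; lra].
- split => //=; first lra.
  by have := dot1 z0 z; rewrite dotq_slice_pt//=; lra.
- lra.
Qed.

Lemma open_disc (Omega : set H) z : open Omega -> Omega z ->
  exists2 r : R, 0 < r & forall w, `|w - z| <= r -> Omega w.
Proof.
move=> oO /oO /nbhs_normP[r r0 h]; exists (r / 2); first by rewrite divr_gt0.
move=> w wr; apply: h => /=; rewrite distrC (le_lt_trans wr)//.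
by rewrite ltr_pdivrMr// ltr_pMr// ltr1n.
Qed.

(** The points near which [f] equals [c] form an open subset of the slice; it is
    relatively closed because, around such a point close enough to a given limit
    point, the larger disc of [slice_const_disc] reaches that limit point. *)
Lemma slice_identity I (Omega : set H) f c z0 (e : R) : unit_sphere I ->
  open Omega -> connected (slice I Omega) ->
  (forall z, line I z -> Omega z -> slice_diff I f z) ->
  line I z0 -> Omega z0 -> 0 < e ->
  (forall z, line I z -> `|z - z0| < e -> f z = c) ->
  forall z, line I z -> Omega z -> f z = c.
Proof.
move=> I1 oO cO fd Iz0 Oz0 e0 fc.
pose C := [set x : R * R | exists2 e : R, 0 < e &
  forall z, line I z -> `|z - slice_pt I x| < e -> f z = c].
have closeby (x : R * R) (r : R) : 0 < r ->
    \forall y \near x, `|slice_pt I x - slice_pt I y| < r.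
  by move=> r0; have /cvgrPdist_lt := @slice_pt_continuous I x; apply.
suff BE : slice I Omega `&` C = slice I Omega.
  move=> z [x _ xz] Oz; have [_ [r r0]] : (slice I Omega `&` C) x.
    by rewrite BE /slice /= xz.
  by apply; [exists x|rewrite xz subrr normr0].
apply: cO.
- by case: Iz0 Oz0 fc => x _ <- Ox fx; exists x; split => //; exists e.
- exists C => //; rewrite openE => x [r r0 h]; rewrite /interior /=.
  near=> y; exists (r / 2) => [|z Iz zy]; first by rewrite divr_gt0.
  apply: h => //; have : `|slice_pt I x - slice_pt I y| < r / 2.
    by near: y; apply: closeby; rewrite divr_gt0.
  have := ler_distD (slice_pt I y) z (slice_pt I x).
  by rewrite (distrC (slice_pt I y) (slice_pt I x)); lra.
- exists (closure (slice I Omega `&` C)); first exact: closed_closure.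
  apply/seteqP; split => [x Bx|x [Ox clx]].
    by split; [case: Bx|exact: subset_closure].
  split => //; have [r r0 h] := open_disc oO Ox.
  have r3 : 0 < r / 3 by rewrite divr_gt0.
  have [y [[Oy [s s0 fs]] xy]] := clx _ (closeby x _ r3).
  exists (r / 6) => [|z Iz zx]; first by rewrite divr_gt0.
  apply: (@slice_const_disc I f c (slice_pt I y) s (r / 2)) => //.
  + by exists y.
  + move=> w Iw wy; apply: fd => //; apply: h; move: xy => /=.
    have := ler_distD (slice_pt I y) w (slice_pt I x).
    by rewrite (distrC (slice_pt I y) (slice_pt I x)); lra.
  + move: xy => /=; have := ler_distD (slice_pt I x) z (slice_pt I y); lra.
Unshelve. all: by end_near. Qed.

(** * Regular functions are differentiable along slices *)

Lemma mvt_origin (g dg : R -> R) (s : R) :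
  (forall t : R, `|t| <= `|s| -> is_derive t 1 g (dg t)) ->
  exists2 t, `|t| <= `|s| & g s - g 0 = dg t * s.
Proof.
move=> gd.
have cont (a b : R) : (forall t, t \in `[a, b]%R -> `|t| <= `|s|) ->
    {within `[a, b], continuous g}.
  move=> ab; apply: derivable_within_continuous => t /ab /gd[? _] //.
have [s0|s0] := leP 0 s.
  have ab t : t \in `[0, s]%R -> `|t| <= `|s|.
    by rewrite in_itv/= => /andP[t0 ts]; rewrite !ger0_norm.
  have [||t /ab ts ->] := @MVT_segment R g dg 0 s s0.
  - by move=> t ts; apply/gd/ab/subset_itv_oo_cc.
  - exact: cont.
  by exists t => //; rewrite subr0.
have ab t : t \in `[s, 0]%R -> `|t| <= `|s|.
  by rewrite in_itv/= => /andP[st t0]; rewrite !ler0_norm ?(ltW s0)// lerN2.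
have [||t /ab ts st] := @MVT_segment R g dg s 0 (ltW s0).
- by move=> t ts; apply/gd/ab/subset_itv_oo_cc.
- exact: cont.
by exists t => //; rewrite -opprB st sub0r mulrN opprK.
Qed.

(** The error vector [E] is tested against itself: the inner product of [E] with
    [G] along the segment is real-valued, so the mean value theorem applies. *)
Lemma directional_mvt (G : R * R -> H) (v z : R * R) (s e : R) (d : H) :
  (forall t : R, `|t| <= `|s| -> derivable G (z + t *: v) v /\
     `|'D_v G (z + t *: v) - d| <= e) ->
  `|G (z + s *: v) - G z - s *: d| <= e * `|s|.
Proof.
move=> Gd; set E := G _ - _ - _.
have [->|E0] := eqVneq E 0.
  rewrite normr0; have := Gd s; rewrite lexx => /(_ isT)[_ h].
  by rewrite mulr_ge0// (le_trans _ h).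
have [|t ts] := @mvt_origin (fun t => dotq E (G (z + t *: v)))
    (fun t => dotq E ('D_v G (z + t *: v))) s.
  move=> t ts; have [Gt _] := Gd t ts.
  have lim : (fun h : R => h^-1 *: (dotq E (G (z + (h *: 1 + t) *: v)) -
        dotq E (G (z + t *: v)))) @ 0^' --> dotq E ('D_v G (z + t *: v)).
    rewrite (_ : (fun h : R => _) = fun h : R => dotq E
        (h^-1 *: (G (h *: v + (z + t *: v)) - G (z + t *: v)))); last first.
      apply/funext => h; rewrite dotqZr dotqBr; congr (_ *: (dotq E (G _) - _)).
      by rewrite [h *: 1]mulr1 scalerDl addrCA.
    by apply: dotq_cvg; exact: Gt.
  by split; [apply/cvg_ex; eexists; exact: lim|exact: cvg_lim lim].
rewrite scale0r addr0 -dotqBr => h.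
have : `|E| ^+ 2 = dotq E ('D_v G (z + t *: v) - d) * s.
  by rewrite -dotqq (dotqBr E _ d) mulrBl -h (mulrC (dotq E d)) -dotqZr -!dotqBr.
have [_ D] := Gd t ts.
have D2 : dotq E ('D_v G (z + t *: v) - d) * s <= `|E| * (e * `|s|).
  apply: le_trans (ler_norm _) _; rewrite normrM mulrA ler_wpM2r//.
  by apply: le_trans (dotq_le _ _) _; rewrite ler_wpM2l.
by move=> e1; move: D2; rewrite -e1 expr2 ler_pM2l ?normr_gt0.
Qed.

(** Move from P to P' first horizontally, then vertically; each move is controlled
    by one continuous partial derivative, and the Cauchy-Riemann equation turns
    the vertical one into I times the horizontal one. *)
Lemma regular_slice_diff (Omega : set H) f I z : open (slice I Omega) ->
  regular Omega f -> unit_sphere I -> line I z -> Omega z -> slice_diff I f z.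
Proof.
move=> oS hf I1 [Z _ <-] OZ; set G := slice_fun I f.
have [[d1 d2 c1 c2] CR] := hf I I1; rewrite -/G in d1 d2 c1 c2 CR.
have II : I * I = -1 by rewrite -expr2.
have [d dE] : exists d, 'D_(1, 0) G Z = d by eexists.
have IdE : 'D_(0, 1) G Z = I * d.
  have := CR Z OZ => /eqP; rewrite scaler_eq0 invr_eq0 pnatr_eq0/= addr_eq0 dE.
  by move=> /eqP ->; rewrite mulrN mulrA II mulN1r opprK.
exists d => e e0; have e2 : 0 < e / 2 by rewrite divr_gt0.
have nr : \forall W \near Z, [/\ slice I Omega W,
    `|'D_(1, 0) G W - d| <= e / 2 & `|'D_(0, 1) G W - I * d| <= e / 2].
  have near_le (g : R * R -> H) : {within slice I Omega, continuous g} ->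
      \forall W \near Z, slice I Omega W -> `|g Z - g W| < e / 2.
    by move=> /subspace_continuousP/(_ Z OZ)/cvgrPdist_lt/(_ _ e2).
  apply: filterS3 (oS Z OZ) (near_le _ c1) (near_le _ c2) => W OW h1 h2.
  move: (h1 OW) (h2 OW); rewrite dE IdE => /ltW {}h1 /ltW {}h2.
  by split; [exact: OW|rewrite distrC; exact: h1|rewrite distrC; exact: h2].
have [delta delta0 hd] : exists2 delta : R, 0 < delta & forall W : R * R,
    `|W.1 - Z.1| < delta -> `|W.2 - Z.2| < delta -> [/\ slice I Omega W,
    `|'D_(1, 0) G W - d| <= e / 2 & `|'D_(0, 1) G W - I * d| <= e / 2].
  move/nbhs_ballP: nr => [delta delta0 h]; exists delta => // W W1 W2.
  by apply: h; split; rewrite /ball/= distrC.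
have coords (P : R * R) : `|P.1| <= `|slice_pt I P| /\ `|P.2| <= `|slice_pt I P|.
  have := norm_slice_pt P I1; have := sqr_ge0 P.1; have := sqr_ge0 P.2.
  move=> h2 h1 h; split; rewrite -(@ler_pXn2r _ 2)// ?nnegrE// h.
    by rewrite real_normK ?num_real//; lra.
  by rewrite real_normK ?num_real//; lra.
(* The bounds on the path are required on both sides of its starting point, so
   up to 2 delta / 3 away from a point that is itself delta / 3 from Z. *)
exists (delta / 3) => [|_ _ [P _ <-] [P' _ <-]]; first by rewrite divr_gt0.
have sB (A B : R * R) : slice_pt I A - slice_pt I B = slice_pt I (A - B).
  by rewrite slice_ptD -[- B]scaleN1r slice_ptZ scaleN1r.
rewrite !sB => PZ P'Z.
have [P1 P2] := coords (P - Z); have [P'1 P'2] := coords (P' - Z).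
have [D1 D2] := coords (P' - P).
have {P1 P2 P'1 P'2} [P1 P2 P'1 P'2] : [/\ `|P.1 - Z.1| < delta / 3,
    `|P.2 - Z.2| < delta / 3, `|P'.1 - Z.1| < delta / 3 &
    `|P'.2 - Z.2| < delta / 3].
  by split; [apply: le_lt_trans P1 _|apply: le_lt_trans P2 _|
    apply: le_lt_trans P'1 _|apply: le_lt_trans P'2 _].
set x := P'.1 - P.1 in D1; set y := P'.2 - P.2 in D2.
have xd : `|x| < delta / 3 * 2.
  have := ler_distD Z.1 P'.1 P.1; rewrite (distrC Z.1) -/x; lra.
have yd : `|y| < delta / 3 * 2.
  have := ler_distD Z.2 P'.2 P.2; rewrite (distrC Z.2) -/y; lra.
have fstE (A v : R * R) (t : R) : (A + t *: v).1 = A.1 + t * v.1 by [].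
have sndE (A v : R * R) (t : R) : (A + t *: v).2 = A.2 + t * v.2 by [].
have hor : `|G (P + x *: (1, 0)) - G P - x *: d| <= e / 2 * `|x|.
  apply: directional_mvt => t tx; have [] := hd (P + t *: (1, 0)).
  - by rewrite fstE mulr1 addrAC; have := ler_normD (P.1 - Z.1) t; lra.
  - by rewrite sndE mulr0 addr0; lra.
  by move=> O ? ?; split => //; exact: d1.
set Q := P + x *: (1, 0) in hor.
have Q1 : Q.1 = P'.1 by rewrite fstE mulr1 /x addrC subrK.
have Q2 : Q.2 = P.2 by rewrite sndE mulr0 addr0.
have ver : `|G (Q + y *: (0, 1)) - G Q - y *: (I * d)| <= e / 2 * `|y|.
  apply: directional_mvt => t ty; have [] := hd (Q + t *: (0, 1)).
  - by rewrite fstE mulr0 addr0 Q1; lra.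
  - by rewrite sndE mulr1 Q2 addrAC; have := ler_normD (P.2 - Z.2) t; lra.
  by move=> O ? ?; split => //; exact: d2.
have Q' : Q + y *: (0, 1) = P'.
  apply: injective_projections; first by rewrite fstE mulr0 addr0.
  by rewrite sndE mulr1 Q2 /y addrC subrK.
rewrite Q' in ver.
have -> : f (slice_pt I P') - f (slice_pt I P) - slice_pt I (P' - P) * d =
    (G P' - G Q - y *: (I * d)) + (G Q - G P - x *: d).
  rewrite (slice_ptE I (P' - P)) /= -/x -/y mulrDl -!scalerAl mul1r.
  rewrite /G /slice_fun.
  move: (f _) (f _) (f _) (x *: d) (y *: _) => F1 F2 F3 X Y.
  by apply: quat_eq => /=; ring.
rewrite (le_trans (ler_normD _ _))//.
have : e / 2 * `|x| <= e / 2 * `|slice_pt I (P' - P)|.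
  by rewrite ler_wpM2l ?divr_ge0 ?(ltW e0).
have : e / 2 * `|y| <= e / 2 * `|slice_pt I (P' - P)|.
  by rewrite ler_wpM2l ?divr_ge0 ?(ltW e0).
by lra.
Qed.

Lemma line_exists q : exists2 I, unit_sphere I & line I q.
Proof.
pose s : R := Num.sqrt (qi q ^+ 2 + qj q ^+ 2 + qk q ^+ 2).
have s2 : s ^+ 2 = qi q ^+ 2 + qj q ^+ 2 + qk q ^+ 2.
  by rewrite sqr_sqrtr// !addr_ge0 ?sqr_ge0.
have [s0|s0] := eqVneq s 0.
  exists (Quat 0 1 0 0).
    by rewrite /unit_sphere /= expr2; apply: quat_eq => /=; ring.
  exists (q1 q, 0) => //; move: s2; rewrite s0 expr0n /= => s2.
  have i2 := sqr_ge0 (qi q); have j2 := sqr_ge0 (qj q); have k2 := sqr_ge0 (qk q).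
  have z (t : R) : t ^+ 2 = 0 -> t = 0 by move=> /eqP; rewrite sqrf_eq0 => /eqP.
  have qi0 : qi q = 0 by apply: z; lra.
  have qj0 : qj q = 0 by apply: z; lra.
  have qk0 : qk q = 0 by apply: z; lra.
  by rewrite slice_ptE; apply: quat_eq => /=; rewrite ?qi0 ?qj0 ?qk0; ring.
exists (Quat 0 (qi q / s) (qj q / s) (qk q / s)).
  rewrite /unit_sphere /= expr2; apply: quat_eq => /=; try by field.
  transitivity (- ((qi q ^+ 2 + qj q ^+ 2 + qk q ^+ 2) / s ^+ 2)); first by field.
  by rewrite -s2 divff// sqrf_eq0.
exists (q1 q, s) => //; rewrite slice_ptE; apply: quat_eq => /=; by field.
Qed.

End SliceAnalysis.

Theorem theorem1p14 (R : realType) (Omega : set (quat R)) (f : quat R -> quat R)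
    (p : quat R) (hOmega : slice_domain Omega) (hf : regular Omega f)
    (hp : relative_max Omega (fun q => `|f q|) p) :
  exists c : quat R, forall q : quat R, Omega q -> f q = c.
Proof.
have [[oO _] [x0 Ox0] dS] := hOmega.
have [Op pmax] := hp.
have fd I : unit_sphere I -> forall z, line I z -> Omega z -> slice_diff I f z.
  by move=> I1 z Iz Oz; apply: (@regular_slice_diff _ Omega) => //; case: (dS I I1).
exists (f p) => q Oq.
(* On a slice through p: the maximum principle, then the identity principle. *)
have [I I1 Ip] := line_exists p.
have onI : forall z, line I z -> Omega z -> f z = f p.
  have /nbhs_normP[e e0 he] := pmax; have [r r0 hr] := open_disc oO Op.
  have {}e0 : 0 < e by exact: e0.
  pose s := Num.min (e / 2) r.
  have s0 : 0 < s by rewrite lt_min divr_gt0.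
  have hs z : `|z - p| <= s -> Omega z /\ `|f z| <= `|f p|.
    rewrite le_min => /andP[z1 z2]; have Oz := hr _ z2; split => //.
    by apply: he => //=; rewrite distrC; lra.
  apply: (@slice_identity _ I Omega f (f p) p s) => //.
  - by case: (dS I I1).
  - exact: fd.
  - move=> z Iz /ltW; move: z Iz; apply: slice_strong_max => // z Iz /hs[] // Oz _.
    exact: fd.
(* On any other slice: f is already constant on the real points of Omega. *)
have [J J1 Jq] := line_exists q.
have [r r0 hr] := open_disc oO Ox0.
apply: (@slice_identity _ J Omega f (f p) (slice_pt J (x0, r / 8)) (r / 8)) => //.
- by case: (dS J J1).
- exact: fd.
- by exists (x0, r / 8).
- apply: hr; rewrite slice_ptE/= addrC addKr normrZ norm_unit// mulr1.
  rewrite ger0_norm; lra.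
- by rewrite divr_gt0.
- apply: slice_const_real => //.
    by move=> z Jz zx; apply: fd => //; exact: hr.
  move=> x xx0; apply: onI; first exact: line_real.
  by apply: hr; rewrite -scalerBl normrZ norm_quat1 mulr1.
Qed.
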